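(* Let $(A,R,S,\alpha,\beta,\xi,\zeta)$ be a double curved Rota-Baxter BiHom-system, with underlying BiHom-associative algebra $(A,\mu,\alpha,\beta)$, satisfying $\mu(\alpha\otimes\zeta)=\mu(\xi\otimes\beta)$ as maps $A\otimes A\otimes A\to A$. Define, for all $a,b,c\in A$, $$T(a\otimes b)=R(a)\otimes b+a\otimes S(b)$$ and $$\mathfrak{T}(a\otimes b\otimes c)=R(a)\otimes R(b)\otimes c+R(a)\otimes b\otimes S(c)+a\otimes S(b)\otimes S(c).$$ Then $T$ is a double curved weak BiHom-pseudotwistor with weak BiHom-companion $\mathfrak{T}$ and curvatures $\xi,\zeta$.
   Context: $K$ is a field; everything is $K$-linear. A BiHom-associative algebra $(A,\mu,\alpha,\beta)$ is a vector space $A$ with linear maps $\mu:A\otimes A\to A$, $\mu(a\otimes b)=ab$, and $\alpha,\beta:A\to A$ with $\alpha\beta=\beta\alpha$, $\alpha(ab)=\alpha(a)\alpha(b)$, $\beta(ab)=\beta(a)\beta(b)$, $\alpha(a)(bc)=(ab)\beta(c)$. A double curved Rota-Baxter BiHom-system $(A,R,S,\alpha,\beta,\xi,\zeta)$ consists of a BiHom-associative algebra $(A,\mu,\alpha,\beta)$ and linear maps $R,S:A\to A$, $\xi,\zeta:A\otimes A\to A$ such that $R$ and $S$ commute with $\alpha$ and $\beta$, and for all $a,b\in A$: $R(a)R(b)=R(R(a)b)+R(aS(b))+\xi(a\otimes b)$ and $S(a)S(b)=S(R(a)b)+S(aS(b))+\zeta(a\otimes b)$. For a BiHom-associative algebra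 $(A,\mu,\alpha,\beta)$, a linear map $T:A\otimes A\to A\otimes A$ is a double curved weak BiHom-pseudotwistor with weak BiHom-companion $\mathfrak{T}:A\otimes A\otimes A\to A\otimes A\otimes A$ and curvatures $\xi,\zeta:A\otimes A\to A$ (all linear) if $\mu(\alpha\otimes\zeta)=\mu(\xi\otimes\beta)$, $T(\alpha\otimes\mu T)=(\alpha\otimes\mu)\mathfrak{T}-\alpha\otimes\zeta$, $T(\mu T\otimes\beta)=(\mu\otimes\beta)\mathfrak{T}-\xi\otimes\beta$, where juxtaposition denotes composition. *)

(* Defs.v *)
From HB Require Import structures.
From mathcomp Require Import all_boot all_algebra.
From mathcomp Require Import boolp.
From mathcomp Require Import freeg.

Set Implicit Arguments.
Unset Strict Implicit.
Unset Printing Implicit Defensive.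

Import GRing.Theory.
Local Open Scope ring_scope.
Local Open Scope quotient_scope.

(* U (x) V is the free K-module on U * V modulo the submodule spanned by the
   bilinearity relations; [tlift] and [tensor_ext] give the universal
   property. *)
Section TensorRelations.
Variables (K : fieldType) (U V : lmodType K).

Definition tgen (u : U) (v : V) : {freeg (U * V)%type / K} :=
  Freeg [:: (1, (u, v))].

Inductive tensor_rel : {freeg (U * V)%type / K} -> Prop :=
| tensor_rel0 : tensor_rel 0
| tensor_relP c x y : tensor_rel x -> tensor_rel y -> tensor_rel (c *: x + y)
| tensor_rel_l c u u' v :
    tensor_rel (tgen (c *: u + u') v - (c *: tgen u v + tgen u' v))
| tensor_rel_r c u v v' :
    tensor_rel (tgen u (c *: v + v') - (c *: tgen u v + tgen u v')).

Definition tensor_relb : {pred {freeg (U * V)%type / K}} :=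
  fun x => `[< tensor_rel x >].

Lemma tensor_relbP x : reflect (tensor_rel x) (x \in tensor_relb).
Proof. exact: asboolP. Qed.

Lemma tensor_rel_zmod : zmod_closed tensor_relb.
Proof.
split=> [|x y /tensor_relbP xP /tensor_relbP yP]; apply/tensor_relbP.
  exact: tensor_rel0.
by rewrite addrC -scaleN1r; apply: tensor_relP.
Qed.

HB.instance Definition _ :=
  GRing.isZmodClosed.Build {freeg (U * V)%type / K} tensor_relb tensor_rel_zmod.

Lemma tensor_relZ c x : x \in tensor_relb -> c *: x \in tensor_relb.
Proof.
move=> /tensor_relbP xP; apply/tensor_relbP.
by rewrite -[_ *: _]addr0; apply: tensor_relP => //; exact: tensor_rel0.
Qed.

End TensorRelations.

Definition tensor_type (K : fieldType) (U V : lmodType K) : Type :=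
  Quotient.quot (@tensor_relb K U V).

Section TensorLmod.
Variables (K : fieldType) (U V : lmodType K).
Local Notation UV := (tensor_type U V).
Local Notation F := {freeg (U * V)%type / K}.

HB.instance Definition _ := GRing.Zmodule.on UV.

Definition tproj (x : F) : UV := \pi_(Quotient.quot (@tensor_relb K U V)) x.

Lemma tprojE x y : (tproj x == tproj y) = (x - y \in @tensor_relb K U V).
Proof. by rewrite Quotient.idealrBE. Qed.

Lemma tprojD x y : tproj (x + y) = tproj x + tproj y.
Proof. exact: Quotient.pi_add. Qed.

Lemma tprojP (x : UV) : exists y, tproj y = x.
Proof. by exists (repr x); apply: reprK. Qed.

Definition tscale (c : K) (x : UV) : UV := tproj (c *: repr x).

Lemma tprojZ c x : tproj (c *: x) = tscale c (tproj x).
Proof.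
apply/eqP; rewrite tprojE -scalerBr; apply: tensor_relZ.
by rewrite -tprojE; apply/eqP/esym/reprK.
Qed.

Fact tscaleA a b x : tscale a (tscale b x) = tscale (a * b) x.
Proof. by have [y <-] := tprojP x; rewrite -!tprojZ scalerA. Qed.

Fact tscale1 : left_id 1 tscale.
Proof. by move=> x; have [y <-] := tprojP x; rewrite -tprojZ scale1r. Qed.

Fact tscaleDr : right_distributive tscale +%R.
Proof.
move=> c x y; have [x' <-] := tprojP x; have [y' <-] := tprojP y.
by rewrite -!(tprojZ, tprojD) scalerDr.
Qed.

Fact tscaleDl x : {morph tscale^~ x : a b / a + b}.
Proof.
by move=> a b; have [y <-] := tprojP x; rewrite -!(tprojZ, tprojD) scalerDl.
Qed.

HB.instance Definition _ := GRing.Zmodule_isLmodule.Build K UV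
  tscaleA tscale1 tscaleDr tscaleDl.

Fact tproj_linear : linear tproj.
Proof. by move=> c x y; rewrite tprojD tprojZ. Qed.

HB.instance Definition _ := GRing.isLinear.Build K F UV *:%R tproj tproj_linear.

End TensorLmod.

Definition tensor (K : fieldType) (U V : lmodType K) : lmodType K :=
  tensor_type U V.

Section Pure.
Variables (K : fieldType) (U V : lmodType K).
Local Notation UV := (tensor U V).

Definition pure (u : U) (v : V) : UV := tproj (tgen u v).

Fact pure_bilinear : bilinear_for *:%R *:%R pure.
Proof.
split=> [v c u u' | u c v v'] /=; rewrite /pure -linearP;
  apply/eqP; rewrite tprojE; apply/tensor_relbP.
- exact: tensor_rel_l.
- exact: tensor_rel_r.
Qed.

HB.instance Definition _ := bilinear_isBilinear.Build K U V UV *:%R *:%R pure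
  pure_bilinear.

End Pure.

Notation "u \ot v" := (pure u v) (at level 40, left associativity) : ring_scope.

Section FreegLift.
Variables (K : fieldType) (T : choiceType) (W : lmodType K) (f : T -> W).

Fact fglift_linear : linear (fglift f : {freeg T / K} -> W).
Proof.
have addf : zmod_morphism (fglift f : {freeg T / K} -> W).
  exact: lift_is_additive.
pose g := GRing.isZmodMorphism.Build {freeg T / K} W (fglift f) addf.
pose h : {additive {freeg T / K} -> W} := HB.pack (fglift f) g.
have hE x : fglift f x = h x by [].
move=> c x y; rewrite !hE raddfD; congr (_ + _).
rewrite -[x in LHS]freeg_sumE scaler_sumr raddf_sum.
rewrite -[x in RHS]freeg_sumE raddf_sum scaler_sumr.
apply: eq_bigr => z _; rewrite -!hE.
suff -> : c *: Freeg [:: (coeff z x, z)] = Freeg [:: (c * coeff z x, z)].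
  by rewrite !liftU scalerA.
by apply/eqP/freeg_eqP => t; rewrite coeffZ !coeffU mulrA.
Qed.

HB.instance Definition _ :=
  GRing.isLinear.Build K {freeg T / K} W *:%R (fglift f) fglift_linear.

End FreegLift.

Section TensorUniversal.
Variables (K : fieldType) (U V : lmodType K).

Lemma tensor_ind (P : tensor U V -> Prop) :
  (forall u v, P (u \ot v)) -> (forall c x y, P x -> P y -> P (c *: x + y)) ->
  forall x, P x.
Proof.
move=> Ppure Plin x; have P0 : P 0.
  have := Plin (-1) _ _ (Ppure 0 0) (Ppure 0 0).
  by rewrite scaleN1r addNr.
have [y <-] := tprojP x; move: y.
apply: (@freeg_ind_dom0 _ _ (P \o @tproj K U V)) => [|c [u v] D _ _ PD] /=.
  by rewrite linear0.
suff -> : Freeg [:: (c, (u, v))] = c *: tgen u v :> {freeg (U * V)%type / K}.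
  rewrite linearP; apply: Plin => //; apply: Ppure.
by apply/eqP/freeg_eqP => t; rewrite coeffZ !coeffU mul1r.
Qed.

Lemma tensor_ext (W : lmodType K) (f g : {linear tensor U V -> W}) :
  (forall u v, f (u \ot v) = g (u \ot v)) -> f =1 g.
Proof.
move=> fg; elim/tensor_ind => [//|c x y Ex Ey].
by rewrite !linearP Ex Ey.
Qed.

Variables (W : lmodType K) (f : {bilinear U -> V -> W}).

Definition tlift (x : tensor U V) : W :=
  fglift (fun uv : U * V => f uv.1 uv.2) (repr x).

Let flift (x : {freeg (U * V)%type / K}) : W :=
  fglift (fun uv : U * V => f uv.1 uv.2) x.

Let flift_tgen u v : flift (tgen u v) = f u v.
Proof. by rewrite /flift /tgen liftU scale1r. Qed.

Let fliftP : linear flift.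
Proof. by move=> c x y; rewrite /flift linearP. Qed.

Let fliftB x y : flift (x - y) = flift x - flift y.
Proof. by rewrite /flift linearB. Qed.

Let flift_rel x : tensor_rel x -> flift x = 0.
Proof.
elim=> [|c {}x y _ Ex _ Ey|c u u' v|c u v v'].
- by rewrite /flift linear0.
- by rewrite fliftP Ex Ey scaler0 addr0.
- by rewrite fliftB fliftP !flift_tgen linearPl subrr.
- by rewrite fliftB fliftP !flift_tgen linearPr subrr.
Qed.

Let tlift_tproj x : tlift (tproj x) = flift x.
Proof.
apply/eqP; rewrite -subr_eq0 -fliftB; apply/eqP/flift_rel/tensor_relbP.
by rewrite -tprojE; apply/eqP/reprK.
Qed.

Fact tlift_linear : linear tlift.
Proof.
move=> c x y; have [x' <-] := tprojP x; have [y' <-] := tprojP y.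
by rewrite -linearP !tlift_tproj fliftP.
Qed.

HB.instance Definition _ :=
  GRing.isLinear.Build K (tensor U V) W *:%R tlift tlift_linear.

Lemma tliftE u v : tlift (u \ot v) = f u v.
Proof. by rewrite tlift_tproj flift_tgen. Qed.

End TensorUniversal.

Section TensorMap.
Variables (K : fieldType) (U U' V V' : lmodType K).
Variables (f : {linear U -> U'}) (g : {linear V -> V'}).

Definition tmap_fun (u : U) (v : V) : tensor U' V' := f u \ot g v.

Fact tmap_fun_bilinear : bilinear_for *:%R *:%R tmap_fun.
Proof.
by split=> [v c u u' | u c v v'] /=; rewrite /tmap_fun linearP ?linearPl ?linearPr.
Qed.

HB.instance Definition _ :=
  bilinear_isBilinear.Build K U V (tensor U' V') *:%R *:%R tmap_fun
    tmap_fun_bilinear.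

Definition tmap : tensor U V -> tensor U' V' := tlift tmap_fun.

HB.instance Definition _ := GRing.Linear.on tmap.

Lemma tmapE u v : tmap (u \ot v) = f u \ot g v.
Proof. exact: tliftE. Qed.

End TensorMap.

Notation "f \ox g" := (tmap f g) (at level 40, left associativity) : ring_scope.

Section TensorAssoc.
Variables (K : fieldType) (U V W : lmodType K).

Definition pure_at (w : W) (v : V) : tensor V W := v \ot w.

Lemma pure_atE w v : pure_at w v = v \ot w.
Proof. by []. Qed.

Fact pure_at_linear w : linear (pure_at w).
Proof. by move=> c v v'; rewrite /pure_at linearPl. Qed.

HB.instance Definition _ w :=
  GRing.isLinear.Build K V (tensor V W) *:%R (pure_at w) (pure_at_linear w).

Definition tassoc_fun (x : tensor U V) (w : W) : tensor U (tensor V W) :=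
  (idfun \ox pure_at w) x.

Fact tassoc_fun_bilinear : bilinear_for *:%R *:%R tassoc_fun.
Proof.
split=> [w | x] c; first exact: linearP.
move=> w w' /=; rewrite /tassoc_fun.
elim/tensor_ind: x => [u v|d x y Ex Ey].
  by rewrite !tmapE /= !pure_atE !linearPr.
have tmapP z : (idfun \ox pure_at z) (d *: x + y) =
    d *: (idfun \ox pure_at z) x + (idfun \ox pure_at z) y by exact: linearP.
by rewrite !tmapP Ex Ey !scalerDr !scalerA [d * c]mulrC addrACA.
Qed.

HB.instance Definition _ :=
  bilinear_isBilinear.Build K (tensor U V) W (tensor U (tensor V W))
    *:%R *:%R tassoc_fun tassoc_fun_bilinear.

Definition tassoc : tensor (tensor U V) W -> tensor U (tensor V W) :=
  tlift tassoc_fun.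

HB.instance Definition _ := GRing.Linear.on tassoc.

Lemma tassocE u v w : tassoc (u \ot v \ot w) = u \ot (v \ot w).
Proof. by rewrite /tassoc tliftE /= /tassoc_fun tmapE. Qed.

End TensorAssoc.

Arguments tassoc {K U V W}.

Record BiHomAlgebra (K : fieldType) := BiHomAlgebra_of {
  bihom_sort :> lmodType K;
  bmu : {linear tensor bihom_sort bihom_sort -> bihom_sort};
  balpha : {linear bihom_sort -> bihom_sort};
  bbeta : {linear bihom_sort -> bihom_sort};
  balphaC : forall a, balpha (bbeta a) = bbeta (balpha a);
  balphaM : forall a b, balpha (bmu (a \ot b)) = bmu (balpha a \ot balpha b);
  bbetaM : forall a b, bbeta (bmu (a \ot b)) = bmu (bbeta a \ot bbeta b);
  bmuA : forall a b c,
    bmu (balpha a \ot bmu (b \ot c)) = bmu (bmu (a \ot b) \ot bbeta c)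
}.

Arguments bmu {K _}.
Arguments balpha {K _}.
Arguments bbeta {K _}.

Notation "a \bmul b" := (bmu (a \ot b)) (at level 40, left associativity) : ring_scope.

Record double_curved_RB_BiHom_system (K : fieldType) (A : BiHomAlgebra K)
    (R S : {linear A -> A}) (xi zeta : {linear tensor A A -> A}) : Prop := {
  RB_R_alpha : forall a, R (balpha a) = balpha (R a);
  RB_R_beta : forall a, R (bbeta a) = bbeta (R a);
  RB_S_alpha : forall a, S (balpha a) = balpha (S a);
  RB_S_beta : forall a, S (bbeta a) = bbeta (S a);
  RB_R_mul : forall a b,
    R a \bmul R b = R (R a \bmul b) + R (a \bmul S b) + xi (a \ot b);
  RB_S_mul : forall a b,
    S a \bmul S b = S (R a \bmul b) + S (a \bmul S b) + zeta (a \ot b)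
}.

(* A (x) A (x) A is (A (x) A) (x) A; maps written on A (x) (A (x) A), such as
   alpha (x) zeta, are precomposed with the associator [tassoc]. *)
Definition curvature_compatible (K : fieldType) (A : BiHomAlgebra K)
    (xi zeta : {linear tensor A A -> A}) : Prop :=
  bmu \o (balpha \ox zeta) \o tassoc =1 bmu \o (xi \ox bbeta).

Record double_curved_weak_BiHom_pseudotwistor (K : fieldType) (A : BiHomAlgebra K)
    (T : {linear tensor A A -> tensor A A})
    (TT : {linear tensor (tensor A A) A -> tensor (tensor A A) A})
    (xi zeta : {linear tensor A A -> A}) : Prop := {
  pseudotwistor_curv : curvature_compatible xi zeta;
  pseudotwistor_l :
    T \o (balpha \ox (bmu \o T)) \o tassoc =1
    ((balpha \ox bmu) \o tassoc \o TT) \- ((balpha \ox zeta) \o tassoc);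
  pseudotwistor_r :
    T \o ((bmu \o T) \ox bbeta) =1 ((bmu \ox bbeta) \o TT) \- (xi \ox bbeta)
}.

Section RBTwistor.
Variables (K : fieldType) (V : lmodType K) (R S : {linear V -> V}).

Lemma RB_twistor_exists : exists T : {linear tensor V V -> tensor V V},
  forall a b, T (a \ot b) = R a \ot b + a \ot S b.
Proof.
by exists ((R \ox idfun) \+ (idfun \ox S)) => a b /=; rewrite !tmapE.
Qed.

Lemma RB_companion_exists :
  exists TT : {linear tensor (tensor V V) V -> tensor (tensor V V) V},
  forall a b c, TT (a \ot b \ot c) =
    R a \ot R b \ot c + R a \ot b \ot S c + a \ot S b \ot S c.
Proof.
exists (((R \ox R) \ox idfun) \+ ((R \ox idfun) \ox S) \+ ((idfun \ox S) \ox S)).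
by move=> a b c /=; rewrite !tmapE /= !tmapE.
Qed.

End RBTwistor.

(* Main.v *)
Require Import Defs.
From HB Require Import structures.
From mathcomp Require Import all_boot all_algebra.

(** Both sides of each twistor identity are linear maps on a threefold tensor
    product, so they need only be compared on decomposable tensors.  There the
    two identities are the two Rota-Baxter equations in disguise.  Applying
    [bmu] to [T (b \ot c)] gives [R b \bmul c + b \bmul S c], which is
    exactly the element to which [S] (respectively [R]) is applied in
    [RB_S_mul] (respectively [RB_R_mul]).  When [T] is applied once more,

    - in the left identity the summand [id (x) S] of [T] produces
      [S b \bmul S c - zeta (b \ot c)] in the right factor;
    - in the right identity the summand [R (x) id] of [T] produces
      [R a \bmul R b - xi (a \ot b)] in the left factor.

    The product terms supply the one summand of [TT] in which the same map is
    applied twice; the other summand of [T] supplies the remaining two, once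
    [R] is moved past [balpha], or [S] past [bbeta].  The curvature terms are
    those subtracted in the definition of a pseudotwistor. *)

Set Implicit Arguments.
Unset Strict Implicit.
Unset Printing Implicit Defensive.

Import GRing.Theory.
Local Open Scope ring_scope.

(** Linearity of [fun x => f (x \ot w)] reduces the inner tensor [x] to
    decomposable ones, after [tensor_ext] has dealt with the outer tensor. *)
Lemma tensor3_ext (K : fieldType) (U V W X : lmodType K)
    (f g : {linear tensor (tensor U V) W -> X}) :
  (forall u v w, f (u \ot v \ot w) = g (u \ot v \ot w)) -> f =1 g.
Proof.
move=> fg; apply: tensor_ext => x w.
elim/tensor_ind: x => [u v|c x y Ex Ey]; first exact: fg.
by rewrite linearPl !linearP Ex Ey.
Qed.

Section RotaBaxterTwistor.
Variables (K : fieldType) (A : BiHomAlgebra K).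
Variables (R S : {linear A -> A}) (xi zeta : {linear tensor A A -> A}).
Hypothesis hRB : double_curved_RB_BiHom_system R S xi zeta.
Variables (T : {linear tensor A A -> tensor A A})
  (TT : {linear tensor (tensor A A) A -> tensor (tensor A A) A}).
Hypothesis hT : forall a b : A, T (a \ot b) = R a \ot b + a \ot S b.
Hypothesis hTT : forall a b c : A, TT (a \ot b \ot c) =
  R a \ot R b \ot c + R a \ot b \ot S c + a \ot S b \ot S c.

Lemma bmu_twistor a b : bmu (T (a \ot b)) = R a \bmul b + a \bmul S b.
Proof. by rewrite hT linearD. Qed.

Lemma RB_R_twistor a b :
  R (bmu (T (a \ot b))) = R a \bmul R b - xi (a \ot b).
Proof. by rewrite bmu_twistor linearD (RB_R_mul hRB) addrK. Qed.

Lemma RB_S_twistor a b :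
  S (bmu (T (a \ot b))) = S a \bmul S b - zeta (a \ot b).
Proof. by rewrite bmu_twistor linearD (RB_S_mul hRB) addrK. Qed.

Lemma RB_twistor_left :
  T \o (balpha \ox (bmu \o T)) \o tassoc =1
  ((balpha \ox bmu) \o tassoc \o TT) \- ((balpha \ox zeta) \o tassoc).
Proof.
apply: tensor3_ext => a b c /=.
rewrite hTT !linearD /= !tassocE !tmapE /= hT.
rewrite RB_S_twistor bmu_twistor (RB_R_alpha hRB).
by rewrite linearDr linearBr addrA.
Qed.

Lemma RB_twistor_right :
  T \o ((bmu \o T) \ox bbeta) =1 ((bmu \ox bbeta) \o TT) \- (xi \ox bbeta).
Proof.
apply: tensor3_ext => a b c /=.
rewrite hTT !linearD /= !tmapE /= hT.
rewrite RB_R_twistor bmu_twistor (RB_S_beta hRB).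
by rewrite linearBl linearDl addrAC !addrA.
Qed.

End RotaBaxterTwistor.

Theorem theorem2p16 (K : fieldType) (A : BiHomAlgebra K)
    (R S : {linear A -> A}) (xi zeta : {linear tensor A A -> A})
    (hRB : double_curved_RB_BiHom_system R S xi zeta)
    (hcurv : curvature_compatible xi zeta)
    (T : {linear tensor A A -> tensor A A})
    (hT : forall a b : A, T (a \ot b) = R a \ot b + a \ot S b)
    (TT : {linear tensor (tensor A A) A -> tensor (tensor A A) A})
    (hTT : forall a b c : A, TT (a \ot b \ot c) =
       R a \ot R b \ot c + R a \ot b \ot S c + a \ot S b \ot S c) :
  double_curved_weak_BiHom_pseudotwistor T TT xi zeta.
Proof.
split=> //.
- exact (RB_twistor_left hRB hT hTT).
- exact (RB_twistor_right hRB hT hTT).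
Qed.
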